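(* Let $G\in\{\mathbf{K},\mathbf{KD},\mathbf{KT},\mathbf{K4},\mathbf{KD4},\mathbf{S4}\}$. Maehara interpolation in $G$ with cuts only on atomic formulas and boxed formulas is complete: for every $G$-provable implication $A\to B$ and every formula $C$ with $V(C)\subseteq V(A)\cap V(B)$ such that $A\to C$ and $C\to B$ are $G$-provable, there is a proof $\pi$ of the split sequent $A;\Rightarrow;B$ in $G$, using only cuts whose cut formula is an atom, $\bot$, $\top$, or of the form $\Box D$, such that $\mathcal{M}(\pi)\leftrightarrow C$ is provable in $G$.
   Context: Modal formulas are built from atoms and $\bot$ using $\wedge,\vee,\neg,\Box$; $A\to B$ abbreviates $\neg A\vee B$, $A\leftrightarrow B$ abbreviates $(A\to B)\wedge(B\to A)$, $\top$ abbreviates $\bot\to\bot$; $V(A)$ is the set of atoms of $A$, extended to multisets. For a multiset $\Gamma$, $\Box\Gamma=\{\Box A\mid A\in\Gamma\}$. $\mathbf{LK}$ here has axioms $p\Rightarrow p$ ($p$ an atom), $\Box A\Rightarrow\Box A$, and $\bot\Rightarrow$, and rules weakening, contraction, $(L\wedge_1),(L\wedge_2),(R\wedge),(R\vee_1),(R\vee_2),(L\vee),(L\neg),(R\neg)$ and cut ($\Gamma\Rightarrow\Delta,A$ and $A,\Gamma\Rightarrow\Delta$ / $\Gamma\Rightarrow\Delta$) in standard Gentzen G1 form. Modal rules: $(K)$: $\Gamma\Rightarrow A$ / $\Box\Gamma\Rightarrow\Box A$; $(D)$: $\Gamma\Rightarrow$ / $\Box\Gamma\Rightarrow$; $(4)$: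 $\Gamma,\Box\Gamma\Rightarrow A$ / $\Box\Gamma\Rightarrow\Box A$; $(T)$: $\Gamma,A\Rightarrow\Delta$ / $\Gamma,\Box A\Rightarrow\Delta$. $\mathbf{K}=\mathbf{LK}+(K)$, $\mathbf{KD}=\mathbf{LK}+(K)+(D)$, $\mathbf{KT}=\mathbf{LK}+(K)+(T)$, $\mathbf{K4}=\mathbf{LK}+(4)$, $\mathbf{KD4}=\mathbf{LK}+(4)+(D)$, $\mathbf{S4}=\mathbf{LK}+(T)+(4)$. A split sequent $\Gamma_1;\Gamma_2\Rightarrow\Delta_1;\Delta_2$ is the sequent $\Gamma_1,\Gamma_2\Rightarrow\Delta_1,\Delta_2$ with formulas divided into a left side ($\Gamma_1,\Delta_1$) and a right side ($\Gamma_2,\Delta_2$). In a proof of a split sequent every sequent is split, context formulas keep their side, auxiliary formulas lie on the side of the main formula (in modal rules each $\Box D$ or $D$ in the conclusion lies on the side of the corresponding premise formula(s)), and for a cut with conclusion $\Gamma_1;\Gamma_2\Rightarrow\Delta_1;\Delta_2$ and cut formula $A$ both occurrences of $A$ lie on the left side (allowed only if $V(A)\subseteq V(\Gamma_1\cup\Delta_1)$) or both on the right side (allowed only if $V(A)\subseteq V(\Gamma_2\cup\Delta_2)$). The Maehara interpolant $\mathcal{M}(\pi)$: for an axiom with formula $X$ (an atom or a boxed formula), $X;\Rightarrow X;$ gives $\bot$, $;X\Rightarrow;X$ gives $\top$, $X;\Rightarrow;X$ gives $X$, $;X\Rightarrow X;$ gives $\neg X$; $\bot;\Rightarrow;$ gives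 $\bot$, $;\bot\Rightarrow;$ gives $\top$; propositional unary rules and $(T)$ keep the premise's interpolant; a binary rule ($(R\wedge)$, $(L\vee)$, cut) with premise proofs $\pi_1,\pi_2$ gives $\mathcal{M}(\pi_1)\vee\mathcal{M}(\pi_2)$ if its main/cut formula is on the left side and $\mathcal{M}(\pi_1)\wedge\mathcal{M}(\pi_2)$ if on the right side; if the premise interpolant is $C$: $(K)$ from $\Gamma_1;\Gamma_2\Rightarrow;A$ to $\Box\Gamma_1;\Box\Gamma_2\Rightarrow;\Box A$ gives $\Box C$, and from $\Gamma_1;\Gamma_2\Rightarrow A;$ to $\Box\Gamma_1;\Box\Gamma_2\Rightarrow\Box A;$ gives $\neg\Box\neg C$; $(4)$ from $\Gamma_1,\Box\Gamma_1;\Gamma_2,\Box\Gamma_2\Rightarrow;A$ (resp. $\Rightarrow A;$) to $\Box\Gamma_1;\Box\Gamma_2\Rightarrow;\Box A$ (resp. $\Rightarrow\Box A;$) gives $\Box C$ (resp. $\neg\Box\neg C$); $(D)$ from $\Gamma_1;\Gamma_2\Rightarrow$ to $\Box\Gamma_1;\Box\Gamma_2\Rightarrow$ gives $\Box C$. *)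

(* Defs.v *)
From Stdlib Require Import List Permutation.
Import ListNotations.

Inductive form : Type :=
| Atom (p : nat)
| Bot
| And (A B : form)
| Or (A B : form)
| Neg (A : form)
| Box (A : form).

Definition Imp (A B : form) : form := Or (Neg A) B.
Definition Iff (A B : form) : form := And (Imp A B) (Imp B A).
Definition Top : form := Imp Bot Bot.

Fixpoint V (A : form) : list nat :=
  match A with
  | Atom p => [p]
  | Bot => []
  | And A B => V A ++ V B
  | Or A B => V A ++ V B
  | Neg A => V A
  | Box A => V A
  end.

Inductive logic : Type := K | KD | KT | K4 | KD4 | S4.

Definition has_K (G : logic) : Prop :=
  match G with K | KD | KT => True | _ => False end.
Definition has_D (G : logic) : Prop :=
  match G with KD | KD4 => True | _ => False end.
Definition has_4 (G : logic) : Prop :=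
  match G with K4 | KD4 | S4 => True | _ => False end.
Definition has_T (G : logic) : Prop :=
  match G with KT | S4 => True | _ => False end.

(* Multisets are lists up to the exchange rule [d_exch].  [derivable G Γ Δ]
   is provability of Γ ⇒ Δ in G, with unrestricted cut. *)
Inductive derivable (G : logic) : list form -> list form -> Prop :=
| d_ax_atom p : derivable G [Atom p] [Atom p]
| d_ax_box A : derivable G [Box A] [Box A]
| d_ax_bot : derivable G [Bot] []
| d_exch Γ Γ' Δ Δ' : Permutation Γ Γ' -> Permutation Δ Δ' ->
    derivable G Γ Δ -> derivable G Γ' Δ'
| d_Lweak A Γ Δ : derivable G Γ Δ -> derivable G (A :: Γ) Δ
| d_Rweak A Γ Δ : derivable G Γ Δ -> derivable G Γ (A :: Δ)
| d_Lcontr A Γ Δ : derivable G (A :: A :: Γ) Δ -> derivable G (A :: Γ) Δ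
| d_Rcontr A Γ Δ : derivable G Γ (A :: A :: Δ) -> derivable G Γ (A :: Δ)
| d_Land1 A B Γ Δ : derivable G (A :: Γ) Δ -> derivable G (And A B :: Γ) Δ
| d_Land2 A B Γ Δ : derivable G (B :: Γ) Δ -> derivable G (And A B :: Γ) Δ
| d_Rand A B Γ Δ : derivable G Γ (A :: Δ) -> derivable G Γ (B :: Δ) ->
    derivable G Γ (And A B :: Δ)
| d_Ror1 A B Γ Δ : derivable G Γ (A :: Δ) -> derivable G Γ (Or A B :: Δ)
| d_Ror2 A B Γ Δ : derivable G Γ (B :: Δ) -> derivable G Γ (Or A B :: Δ)
| d_Lor A B Γ Δ : derivable G (A :: Γ) Δ -> derivable G (B :: Γ) Δ ->
    derivable G (Or A B :: Γ) Δ
| d_Lneg A Γ Δ : derivable G Γ (A :: Δ) -> derivable G (Neg A :: Γ) Δ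
| d_Rneg A Γ Δ : derivable G (A :: Γ) Δ -> derivable G Γ (Neg A :: Δ)
| d_cut A Γ Δ : derivable G Γ (A :: Δ) -> derivable G (A :: Γ) Δ ->
    derivable G Γ Δ
| d_K A Γ : has_K G -> derivable G Γ [A] -> derivable G (map Box Γ) [Box A]
| d_D Γ : has_D G -> derivable G Γ [] -> derivable G (map Box Γ) []
| d_4 A Γ : has_4 G -> derivable G (Γ ++ map Box Γ) [A] ->
    derivable G (map Box Γ) [Box A]
| d_T A Γ Δ : has_T G -> derivable G (A :: Γ) Δ -> derivable G (Box A :: Γ) Δ.

Definition provable (G : logic) (A : form) : Prop := derivable G [] [A].

Inductive side : Type := Lft | Rgt.

Definition side_eqb (s t : side) : bool :=
  match s, t with Lft, Lft | Rgt, Rgt => true | _, _ => false end.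

(* A split sequent Γ1;Γ2 ⇒ Δ1;Δ2 is a sequent whose formula occurrences are
   tagged with their side: Γ1 (resp. Γ2) is the part of the antecedent tagged
   [Lft] (resp. [Rgt]), and likewise for the succedent. *)
Definition sform : Type := (side * form)%type.

Definition on_side (s : side) (Γ : list sform) : list form :=
  map snd (filter (fun x => side_eqb (fst x) s) Γ).

Definition Vside (s : side) (Γ Δ : list sform) : list nat :=
  flat_map V (on_side s Γ ++ on_side s Δ).

Definition sboxes (Γ : list sform) : list sform :=
  map (fun x => (fst x, Box (snd x))) Γ.

Inductive split_proof (G : logic) : list sform -> list sform -> Type :=
| s_ax_atom s t p : split_proof G [(s, Atom p)] [(t, Atom p)]
| s_ax_box s t A : split_proof G [(s, Box A)] [(t, Box A)]
| s_ax_bot s : split_proof G [(s, Bot)] []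
| s_exch Γ Γ' Δ Δ' : Permutation Γ Γ' -> Permutation Δ Δ' ->
    split_proof G Γ Δ -> split_proof G Γ' Δ'
| s_Lweak s A Γ Δ : split_proof G Γ Δ -> split_proof G ((s, A) :: Γ) Δ
| s_Rweak s A Γ Δ : split_proof G Γ Δ -> split_proof G Γ ((s, A) :: Δ)
| s_Lcontr s A Γ Δ : split_proof G ((s, A) :: (s, A) :: Γ) Δ ->
    split_proof G ((s, A) :: Γ) Δ
| s_Rcontr s A Γ Δ : split_proof G Γ ((s, A) :: (s, A) :: Δ) ->
    split_proof G Γ ((s, A) :: Δ)
| s_Land1 s A B Γ Δ : split_proof G ((s, A) :: Γ) Δ ->
    split_proof G ((s, And A B) :: Γ) Δ
| s_Land2 s A B Γ Δ : split_proof G ((s, B) :: Γ) Δ ->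
    split_proof G ((s, And A B) :: Γ) Δ
| s_Rand s A B Γ Δ : split_proof G Γ ((s, A) :: Δ) ->
    split_proof G Γ ((s, B) :: Δ) -> split_proof G Γ ((s, And A B) :: Δ)
| s_Ror1 s A B Γ Δ : split_proof G Γ ((s, A) :: Δ) ->
    split_proof G Γ ((s, Or A B) :: Δ)
| s_Ror2 s A B Γ Δ : split_proof G Γ ((s, B) :: Δ) ->
    split_proof G Γ ((s, Or A B) :: Δ)
| s_Lor s A B Γ Δ : split_proof G ((s, A) :: Γ) Δ ->
    split_proof G ((s, B) :: Γ) Δ -> split_proof G ((s, Or A B) :: Γ) Δ
| s_Lneg s A Γ Δ : split_proof G Γ ((s, A) :: Δ) ->
    split_proof G ((s, Neg A) :: Γ) Δ
| s_Rneg s A Γ Δ : split_proof G ((s, A) :: Γ) Δ ->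
    split_proof G Γ ((s, Neg A) :: Δ)
| s_cut s A Γ Δ : incl (V A) (Vside s Γ Δ) ->
    split_proof G Γ ((s, A) :: Δ) -> split_proof G ((s, A) :: Γ) Δ ->
    split_proof G Γ Δ
| s_K s A Γ : has_K G -> split_proof G Γ [(s, A)] ->
    split_proof G (sboxes Γ) [(s, Box A)]
| s_D Γ : has_D G -> split_proof G Γ [] -> split_proof G (sboxes Γ) []
| s_4 s A Γ : has_4 G -> split_proof G (Γ ++ sboxes Γ) [(s, A)] ->
    split_proof G (sboxes Γ) [(s, Box A)]
| s_T s A Γ Δ : has_T G -> split_proof G ((s, A) :: Γ) Δ ->
    split_proof G ((s, Box A) :: Γ) Δ.

Definition maehara_ax (s t : side) (X : form) : form :=
  match s, t with
  | Lft, Lft => Bot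
  | Rgt, Rgt => Top
  | Lft, Rgt => X
  | Rgt, Lft => Neg X
  end.

Definition maehara_bin (s : side) (C1 C2 : form) : form :=
  match s with Lft => Or C1 C2 | Rgt => And C1 C2 end.

Definition maehara_box (s : side) (C : form) : form :=
  match s with Lft => Neg (Box (Neg C)) | Rgt => Box C end.

Fixpoint maehara {G : logic} {Γ Δ : list sform} (π : split_proof G Γ Δ)
  : form :=
  match π with
  | s_ax_atom _ s t p => maehara_ax s t (Atom p)
  | s_ax_box _ s t A => maehara_ax s t (Box A)
  | s_ax_bot _ s => match s with Lft => Bot | Rgt => Top end
  | s_exch _ _ _ _ _ _ _ π1 => maehara π1
  | s_Lweak _ _ _ _ _ π1 => maehara π1
  | s_Rweak _ _ _ _ _ π1 => maehara π1
  | s_Lcontr _ _ _ _ _ π1 => maehara π1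
  | s_Rcontr _ _ _ _ _ π1 => maehara π1
  | s_Land1 _ _ _ _ _ _ π1 => maehara π1
  | s_Land2 _ _ _ _ _ _ π1 => maehara π1
  | s_Rand _ s _ _ _ _ π1 π2 => maehara_bin s (maehara π1) (maehara π2)
  | s_Ror1 _ _ _ _ _ _ π1 => maehara π1
  | s_Ror2 _ _ _ _ _ _ π1 => maehara π1
  | s_Lor _ s _ _ _ _ π1 π2 => maehara_bin s (maehara π1) (maehara π2)
  | s_Lneg _ _ _ _ _ π1 => maehara π1
  | s_Rneg _ _ _ _ _ π1 => maehara π1
  | s_cut _ s _ _ _ _ π1 π2 => maehara_bin s (maehara π1) (maehara π2)
  | s_K _ s _ _ _ π1 => maehara_box s (maehara π1)
  | s_D _ _ _ π1 => Box (maehara π1)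
  | s_4 _ s _ _ _ π1 => maehara_box s (maehara π1)
  | s_T _ _ _ _ _ _ π1 => maehara π1
  end.

Fixpoint all_cuts (P : form -> Prop) {G : logic} {Γ Δ : list sform}
  (π : split_proof G Γ Δ) : Prop :=
  match π with
  | s_ax_atom _ _ _ _ => True
  | s_ax_box _ _ _ _ => True
  | s_ax_bot _ _ => True
  | s_exch _ _ _ _ _ _ _ π1 => all_cuts P π1
  | s_Lweak _ _ _ _ _ π1 => all_cuts P π1
  | s_Rweak _ _ _ _ _ π1 => all_cuts P π1
  | s_Lcontr _ _ _ _ _ π1 => all_cuts P π1
  | s_Rcontr _ _ _ _ _ π1 => all_cuts P π1
  | s_Land1 _ _ _ _ _ _ π1 => all_cuts P π1
  | s_Land2 _ _ _ _ _ _ π1 => all_cuts P π1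
  | s_Rand _ _ _ _ _ _ π1 π2 => all_cuts P π1 /\ all_cuts P π2
  | s_Ror1 _ _ _ _ _ _ π1 => all_cuts P π1
  | s_Ror2 _ _ _ _ _ _ π1 => all_cuts P π1
  | s_Lor _ _ _ _ _ _ π1 π2 => all_cuts P π1 /\ all_cuts P π2
  | s_Lneg _ _ _ _ _ π1 => all_cuts P π1
  | s_Rneg _ _ _ _ _ π1 => all_cuts P π1
  | s_cut _ _ A _ _ _ π1 π2 => P A /\ all_cuts P π1 /\ all_cuts P π2
  | s_K _ _ _ _ _ π1 => all_cuts P π1
  | s_D _ _ _ π1 => all_cuts P π1
  | s_4 _ _ _ _ _ π1 => all_cuts P π1
  | s_T _ _ _ _ _ _ π1 => all_cuts P π1
  end.

Definition atomic_or_boxed (A : form) : Prop :=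
  (exists p, A = Atom p) \/ A = Bot \/ A = Top \/ (exists D, A = Box D).

(* Main.v *)
Require Import Defs.
From Stdlib Require Import List Permutation Bool.
Import ListNotations.

(** Call atoms and boxed formulas prime, and let X_1, ..., X_n be the prime
    formulas from which C is built propositionally.  Starting from A; => ;B,
    cut on every X_i on the left side.  At a branch whose choice v of truth
    values falsifies C, the left part of the sequent is provable because A
    entails C, and a proof living on the left side has an interpolant
    equivalent to falsity.  At a branch verifying C, cut again on every X_i, now
    on the right side: the premise that disagrees with v is an axiom across the
    two sides, contributing the literal of v at X_i, and after the last cut the
    right part is provable because C entails B.  The interpolant obtained is the
    disjunctive normal form of C.

    One-sided provable sequents must have proofs whose cuts are prime and use
    only atoms of the conclusion of the cut.  Extraneous atoms are removed by
    substituting falsity for them, and a cut on a compound formula is replaced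
    by cuts on its prime formulas. *)

(** * Structural rules *)

(** Weakening gives [P (l ++ l')]; each element of [l] then has a second copy further on, into which
    it is contracted. The abstract [P] serves both plain provability and provability with a given
    interpolant. *)
Lemma incl_closed {T : Type} (P : list T -> Prop)
  (Pperm : forall l l', Permutation l l' -> P l -> P l')
  (Pweak : forall x l, P l -> P (x :: l))
  (Pcontr : forall x l, P (x :: x :: l) -> P (x :: l)) l l' :
  incl l l' -> P l -> P l'.
Proof.
  intros Hi Hl.
  assert (Happ : P (l ++ l')).
  { apply (Pperm (l' ++ l)); [apply Permutation_app_comm|].
    clear Hi; induction l' as [|x l' IH]; simpl; auto. }
  clear Hl; induction l as [|x l IH]; simpl in *; [exact Happ|].
  apply incl_cons_inv in Hi as [Hx Hi].
  apply IH; [exact Hi|].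
  destruct (in_split x (l ++ l')) as [l1 [l2 E]]; [apply in_app_iff; auto|].
  rewrite E in *.
  apply (Pperm (x :: l1 ++ l2)); [apply Permutation_middle|].
  apply Pcontr, (Pperm (x :: l1 ++ x :: l2)); [|exact Happ].
  apply perm_skip; symmetry; apply Permutation_middle.
Qed.

Ltac solve_incl :=
  let z := fresh "z" in
  let Hz := fresh "Hz" in
  intros z Hz; repeat (rewrite in_app_iff in * || simpl in *);
  intuition (subst; auto).

Lemma derivable_incl G Γ Δ Γ' Δ' :
  incl Γ Γ' -> incl Δ Δ' -> derivable G Γ Δ -> derivable G Γ' Δ'.
Proof.
  intros HΓ HΔ H.
  apply (incl_closed (fun l => derivable G l Δ')) with (l := Γ); auto.
  - intros l l' Hp; apply d_exch; auto.
  - intros; now apply d_Lweak.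
  - intros; now apply d_Lcontr.
  - apply (incl_closed (fun l => derivable G Γ l)) with (l := Δ); auto.
    + intros l l' Hp; apply d_exch; auto.
    + intros; now apply d_Rweak.
    + intros; now apply d_Rcontr.
Qed.

Ltac weaken H := refine (derivable_incl _ _ _ _ _ _ _ H); solve_incl.

Lemma derivable_id G A : derivable G [A] [A].
Proof.
  induction A.
  - apply d_ax_atom.
  - weaken (d_ax_bot G).
  - apply d_Rand; [apply d_Land1 | apply d_Land2]; assumption.
  - apply d_Lor; [apply d_Ror1 | apply d_Ror2]; assumption.
  - apply d_Rneg, (d_exch G [Neg A; A] _ [] _); [constructor|auto|].
    apply d_Lneg; assumption.
  - apply d_ax_box.
Qed.

Lemma derivable_in G A Γ Δ : In A Γ -> In A Δ -> derivable G Γ Δ.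
Proof. intros; weaken (derivable_id G A). Qed.

Lemma derivable_Land G A B Γ Δ :
  derivable G (A :: B :: Γ) Δ -> derivable G (And A B :: Γ) Δ.
Proof.
  intro H; apply d_Lcontr, d_Land1.
  apply (d_exch G (And A B :: A :: Γ) _ Δ _); [constructor|auto|].
  apply d_Land2; weaken H.
Qed.

Lemma derivable_Ror G A B Γ Δ :
  derivable G Γ (A :: B :: Δ) -> derivable G Γ (Or A B :: Δ).
Proof.
  intro H; apply d_Rcontr, d_Ror1.
  apply (d_exch G Γ _ (Or A B :: A :: Δ) _); [auto|constructor|].
  apply d_Ror2; weaken H.
Qed.

Lemma provable_Imp G A B : provable G (Imp A B) <-> derivable G [A] [B].
Proof.
  split; intro H.
  - apply d_cut with (Imp A B); [weaken H|].
    apply d_Lor; [apply d_Lneg, (derivable_in G A)|apply (derivable_in G B)];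
      simpl; auto.
  - apply derivable_Ror, d_Rneg; exact H.
Qed.

Lemma provable_Iff G A B :
  derivable G [A] [B] -> derivable G [B] [A] -> provable G (Iff A B).
Proof. intros; apply d_Rand; apply provable_Imp; assumption. Qed.

(** * Prime formulas and valuations *)

Definition prime (A : form) : Prop :=
  match A with Atom _ | Box _ => True | _ => False end.

Fixpoint primes (A : form) : list form :=
  match A with
  | Atom _ | Box _ => [A]
  | Bot => []
  | And A B | Or A B => primes A ++ primes B
  | Neg A => primes A
  end.

Lemma primes_prime A X : In X (primes A) -> prime X.
Proof.
  induction A; simpl; try rewrite in_app_iff; intuition (subst; simpl; auto).
Qed.

Lemma V_primes A X : In X (primes A) -> incl (V X) (V A).
Proof.
  induction A; simpl; try rewrite in_app_iff; intros H;
    intuition (subst; auto using incl_refl, incl_appl, incl_appr).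
Qed.

(* [A] gets the value [b] when the prime formulas in [Γ] are true and those in
   [Δ] are false; [Γ] and [Δ] need be neither disjoint nor exhaustive. *)
Fixpoint val (b : bool) (Γ Δ : list form) (A : form) : Prop :=
  match A with
  | Atom _ | Box _ => In A (if b then Γ else Δ)
  | Bot => b = false
  | And A B => if b then val true Γ Δ A /\ val true Γ Δ B
               else val false Γ Δ A \/ val false Γ Δ B
  | Or A B => if b then val true Γ Δ A \/ val true Γ Δ B
              else val false Γ Δ A /\ val false Γ Δ B
  | Neg A => val (negb b) Γ Δ A
  end.

Lemma val_incl b Γ Δ Γ' Δ' A :
  incl Γ Γ' -> incl Δ Δ' -> val b Γ Δ A -> val b Γ' Δ' A.
Proof.
  intros HΓ HΔ; revert b; induction A; intros [|]; simpl; firstorder.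
Qed.

Lemma val_total Γ Δ A :
  (forall X, In X (primes A) -> In X Γ \/ In X Δ) ->
  val true Γ Δ A \/ val false Γ Δ A.
Proof.
  induction A; simpl; intros H.
  - apply H; auto.
  - auto.
  - assert (val true Γ Δ A1 \/ val false Γ Δ A1)
      by (apply IHA1; intros; apply H, in_app_iff; auto).
    assert (val true Γ Δ A2 \/ val false Γ Δ A2)
      by (apply IHA2; intros; apply H, in_app_iff; auto).
    tauto.
  - assert (val true Γ Δ A1 \/ val false Γ Δ A1)
      by (apply IHA1; intros; apply H, in_app_iff; auto).
    assert (val true Γ Δ A2 \/ val false Γ Δ A2)
      by (apply IHA2; intros; apply H, in_app_iff; auto).
    tauto.
  - apply IHA in H; tauto.
  - apply H; auto.
Qed.

(** Kalmár's truth-table lemma: each evaluation clause is matched by a rule, and prime formulas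
    close by identity. *)
Lemma val_derivable G b Γ Δ A :
  val b Γ Δ A ->
  if b then derivable G Γ (A :: Δ) else derivable G (A :: Γ) Δ.
Proof.
  revert b; induction A; intros [|]; simpl; intros H.
  - apply (derivable_in G (Atom p)); simpl; auto.
  - apply (derivable_in G (Atom p)); simpl; auto.
  - discriminate.
  - weaken (d_ax_bot G).
  - destruct H as [H1 H2].
    apply d_Rand; [apply (IHA1 true) | apply (IHA2 true)]; assumption.
  - destruct H as [H|H];
      [apply d_Land1, (IHA1 false) | apply d_Land2, (IHA2 false)]; assumption.
  - destruct H as [H|H];
      [apply d_Ror1, (IHA1 true) | apply d_Ror2, (IHA2 true)]; assumption.
  - destruct H as [H1 H2].
    apply d_Lor; [apply (IHA1 false) | apply (IHA2 false)]; assumption.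
  - apply d_Rneg, (IHA false), H.
  - apply d_Lneg, (IHA true), H.
  - apply (derivable_in G (Box A)); simpl; auto.
  - apply (derivable_in G (Box A)); simpl; auto.
Qed.

(** * Prime cuts on the atoms of the conclusion *)

Definition VS (Γ Δ : list form) : list nat := flat_map V (Γ ++ Δ).

Lemma in_VS p Γ Δ :
  In p (VS Γ Δ) <-> exists X, (In X Γ \/ In X Δ) /\ In p (V X).
Proof.
  unfold VS; rewrite in_flat_map; setoid_rewrite in_app_iff; firstorder.
Qed.

Lemma VS_incl Γ Δ Γ' Δ' :
  incl Γ Γ' -> incl Δ Δ' -> incl (VS Γ Δ) (VS Γ' Δ').
Proof.
  intros HΓ HΔ p; rewrite !in_VS; intros [X [HX Hp]]; exists X; firstorder.
Qed.

Lemma V_VS_l X Γ Δ : In X Γ -> incl (V X) (VS Γ Δ).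
Proof. intros HX p Hp; apply in_VS; eauto. Qed.

Lemma V_VS_r X Γ Δ : In X Δ -> incl (V X) (VS Γ Δ).
Proof. intros HX p Hp; apply in_VS; eauto. Qed.

(** The unsplit image of a proof lying on one side: cuts are prime and [VS] takes the role of
    [Vside]. All structural rules merge into [r_incl]. *)
Inductive rderivable (G : logic) : list form -> list form -> Prop :=
| r_ax_atom p : rderivable G [Atom p] [Atom p]
| r_ax_box A : rderivable G [Box A] [Box A]
| r_ax_bot : rderivable G [Bot] []
| r_incl Γ Γ' Δ Δ' : incl Γ Γ' -> incl Δ Δ' ->
    rderivable G Γ Δ -> rderivable G Γ' Δ'
| r_Land1 A B Γ Δ : rderivable G (A :: Γ) Δ -> rderivable G (And A B :: Γ) Δ
| r_Land2 A B Γ Δ : rderivable G (B :: Γ) Δ -> rderivable G (And A B :: Γ) Δ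
| r_Rand A B Γ Δ : rderivable G Γ (A :: Δ) -> rderivable G Γ (B :: Δ) ->
    rderivable G Γ (And A B :: Δ)
| r_Ror1 A B Γ Δ : rderivable G Γ (A :: Δ) -> rderivable G Γ (Or A B :: Δ)
| r_Ror2 A B Γ Δ : rderivable G Γ (B :: Δ) -> rderivable G Γ (Or A B :: Δ)
| r_Lor A B Γ Δ : rderivable G (A :: Γ) Δ -> rderivable G (B :: Γ) Δ ->
    rderivable G (Or A B :: Γ) Δ
| r_Lneg A Γ Δ : rderivable G Γ (A :: Δ) -> rderivable G (Neg A :: Γ) Δ
| r_Rneg A Γ Δ : rderivable G (A :: Γ) Δ -> rderivable G Γ (Neg A :: Δ)
| r_cut A Γ Δ : prime A -> incl (V A) (VS Γ Δ) ->
    rderivable G Γ (A :: Δ) -> rderivable G (A :: Γ) Δ -> rderivable G Γ Δ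
| r_K A Γ : has_K G -> rderivable G Γ [A] -> rderivable G (map Box Γ) [Box A]
| r_D Γ : has_D G -> rderivable G Γ [] -> rderivable G (map Box Γ) []
| r_4 A Γ : has_4 G -> rderivable G (Γ ++ map Box Γ) [A] ->
    rderivable G (map Box Γ) [Box A]
| r_T A Γ Δ : has_T G -> rderivable G (A :: Γ) Δ ->
    rderivable G (Box A :: Γ) Δ.

(* The second alternative keeps track of the atoms, so that erasing [X] does
   not invalidate the side condition of a cut. *)
Definition absorbed (b : bool) (Γ Δ : list form) (X : form) : Prop :=
  In X (if b then Γ else Δ) \/ (val b Γ Δ X /\ incl (V X) (VS Γ Δ)).

Lemma absorbed_incl b Γ Δ Γ' Δ' X :
  incl Γ Γ' -> incl Δ Δ' -> absorbed b Γ Δ X -> absorbed b Γ' Δ' X.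
Proof.
  intros HΓ HΔ [H|[H1 H2]]; [left; destruct b; auto|right; split].
  - eapply val_incl; eauto.
  - eapply incl_tran; [exact H2|]; apply VS_incl; assumption.
Qed.

Lemma absorbed_prime b Γ Δ X :
  prime X -> absorbed b Γ Δ X -> In X (if b then Γ else Δ).
Proof. destruct X; simpl; intros HX H; destruct H as [H|[H _]]; tauto. Qed.

Lemma absorbed_V b Γ Δ X : absorbed b Γ Δ X -> incl (V X) (VS Γ Δ).
Proof.
  intros [H|[_ H]]; [|exact H].
  destruct b; [apply V_VS_l | apply V_VS_r]; exact H.
Qed.

Lemma absorbed_cons_l Γ Δ Y :
  forall b X, absorbed b Γ Δ X -> absorbed b (Y :: Γ) Δ X.
Proof.
  intros b X; apply absorbed_incl; [apply incl_tl|]; apply incl_refl.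
Qed.

Lemma absorbed_cons_r Γ Δ Y :
  forall b X, absorbed b Γ Δ X -> absorbed b Γ (Y :: Δ) X.
Proof.
  intros b X; apply absorbed_incl; [|apply incl_tl]; apply incl_refl.
Qed.

Lemma absorbed_here_l Γ Δ Y : absorbed true (Y :: Γ) Δ Y.
Proof. left; left; reflexivity. Qed.

Lemma absorbed_here_r Γ Δ Y : absorbed false Γ (Y :: Δ) Y.
Proof. left; left; reflexivity. Qed.

Lemma Forall_absorbed_boxes Γ Γ' Δ' :
  Forall (absorbed true Γ' Δ') (map Box Γ) -> incl (map Box Γ) Γ'.
Proof.
  rewrite Forall_forall; intros H X HX.
  apply (absorbed_prime true Γ' Δ'); auto.
  apply in_map_iff in HX as [Y [<- _]]; exact I.
Qed.

Lemma rderivable_Lin G X Γ Δ :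
  In X Γ -> rderivable G (X :: Γ) Δ -> rderivable G Γ Δ.
Proof. intros HX; apply r_incl; [apply incl_cons|]; auto using incl_refl. Qed.

Lemma rderivable_Rin G X Γ Δ :
  In X Δ -> rderivable G Γ (X :: Δ) -> rderivable G Γ Δ.
Proof.
  intros HX; apply r_incl; [|apply incl_cons]; auto using incl_refl.
Qed.

Ltac split_incl :=
  match goal with
  | H : incl (_ ++ _) _ |- _ => apply incl_app_inv in H as [? ?]
  end.

Ltac absorb :=
  repeat match goal with |- Forall _ (_ :: _) => constructor end;
  auto using absorbed_here_l, absorbed_here_r;
  try (eapply Forall_impl;
    [first [apply absorbed_cons_l | apply absorbed_cons_r] | assumption]);
  try (right; split; assumption).

(** A true formula on the left or a false one on the right can be erased: its rule is skipped, since
    the components in a suitable premise are again absorbed. Axioms and modal rules survive, because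
    a prime formula is absorbed only by being present and [Bot] is never true. *)
Lemma rderivable_absorb G Γ Δ :
  rderivable G Γ Δ -> forall Γ' Δ',
  Forall (absorbed true Γ' Δ') Γ -> Forall (absorbed false Γ' Δ') Δ ->
  rderivable G Γ' Δ'.
Proof.
  induction 1; intros Γ1 Δ1 HL HR;
    try (apply Forall_cons_iff in HL as [HA HL]);
    try (apply Forall_cons_iff in HR as [HB HR]).
  - apply absorbed_prime in HA, HB; [|exact I..].
    eapply r_incl; [| |apply r_ax_atom]; apply incl_cons; eauto using incl_nil_l.
  - apply absorbed_prime in HA, HB; [|exact I..].
    eapply r_incl; [| |apply r_ax_box]; apply incl_cons; eauto using incl_nil_l.
  - destruct HA as [HA|[HA _]]; [|discriminate].
    eapply r_incl; [| |apply r_ax_bot]; [apply incl_cons|];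
      eauto using incl_nil_l.
  - apply IHrderivable; eapply incl_Forall; eauto.
  - destruct HA as [HA|[[? ?] HV]]; simpl in *; [|split_incl].
    + apply (rderivable_Lin _ _ _ _ HA), r_Land1, IHrderivable; absorb.
    + apply IHrderivable; absorb.
  - destruct HA as [HA|[[? ?] HV]]; simpl in *; [|split_incl].
    + apply (rderivable_Lin _ _ _ _ HA), r_Land2, IHrderivable; absorb.
    + apply IHrderivable; absorb.
  - destruct HB as [HB|[[?|?] HV]]; simpl in *; [|split_incl..].
    + apply (rderivable_Rin _ _ _ _ HB), r_Rand;
        [apply IHrderivable1 | apply IHrderivable2]; absorb.
    + apply IHrderivable1; absorb.
    + apply IHrderivable2; absorb.
  - destruct HB as [HB|[[? ?] HV]]; simpl in *; [|split_incl].
    + apply (rderivable_Rin _ _ _ _ HB), r_Ror1, IHrderivable; absorb.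
    + apply IHrderivable; absorb.
  - destruct HB as [HB|[[? ?] HV]]; simpl in *; [|split_incl].
    + apply (rderivable_Rin _ _ _ _ HB), r_Ror2, IHrderivable; absorb.
    + apply IHrderivable; absorb.
  - destruct HA as [HA|[[?|?] HV]]; simpl in *; [|split_incl..].
    + apply (rderivable_Lin _ _ _ _ HA), r_Lor;
        [apply IHrderivable1 | apply IHrderivable2]; absorb.
    + apply IHrderivable1; absorb.
    + apply IHrderivable2; absorb.
  - destruct HA as [HA|[? HV]]; simpl in *.
    + apply (rderivable_Lin _ _ _ _ HA), r_Lneg, IHrderivable; absorb.
    + apply IHrderivable; absorb.
  - destruct HB as [HB|[? HV]]; simpl in *.
    + apply (rderivable_Rin _ _ _ _ HB), r_Rneg, IHrderivable; absorb.
    + apply IHrderivable; absorb.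
  (* A prime cut is kept; its side condition survives because every absorbed formula has its atoms
     in the new sequent. *)
  - apply r_cut with A; [assumption| | |].
    + intros p Hp; apply H0, in_VS in Hp as [X [[HX|HX] Hp]];
        [rewrite Forall_forall in HL | rewrite Forall_forall in HR];
        eapply absorbed_V; eauto.
    + apply IHrderivable1; absorb.
    + apply IHrderivable2; absorb.
  - apply Forall_absorbed_boxes in HL.
    apply absorbed_prime in HB; [|exact I].
    eapply r_incl; [exact HL| |apply r_K; eassumption].
    apply incl_cons; auto using incl_nil_l.
  - apply Forall_absorbed_boxes in HL.
    eapply r_incl; [exact HL|apply incl_nil_l|apply r_D; eassumption].
  - apply Forall_absorbed_boxes in HL.
    apply absorbed_prime in HB; [|exact I].
    eapply r_incl; [exact HL| |apply r_4; eassumption].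
    apply incl_cons; auto using incl_nil_l.
  - apply absorbed_prime in HA; [|exact I].
    apply (rderivable_Lin _ _ _ _ HA), r_T, IHrderivable; absorb.
Qed.

(** Cutting on the members of [Xs] in turn leaves branches in which each has been given a side.
    Sequents only grow along a branch, so the side conditions of later cuts persist. *)
Lemma rderivable_split_primes G Xs Γ Δ :
  (forall X, In X Xs -> prime X /\ incl (V X) (VS Γ Δ)) ->
  (forall Γ' Δ', incl Γ Γ' -> incl Δ Δ' ->
    (forall X, In X Xs -> In X Γ' \/ In X Δ') -> rderivable G Γ' Δ') ->
  rderivable G Γ Δ.
Proof.
  revert Γ Δ; induction Xs as [|X Xs IH]; intros Γ Δ HX H.
  - apply H; auto using incl_refl; contradiction.
  - destruct (HX X) as [Hp HV]; [left; reflexivity|].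
    apply (r_cut G X); auto; apply IH.
    + intros Y HY; destruct (HX Y) as [? ?]; [right; exact HY|split; auto].
      eapply incl_tran; [eassumption|]; apply VS_incl;
        auto using incl_refl, incl_tl.
    + intros Γ' Δ' H1 H2 H3; apply incl_cons_inv in H2 as [H2 H2'].
      apply H; auto; intros Y [<-|HY]; auto.
    + intros Y HY; destruct (HX Y) as [? ?]; [right; exact HY|split; auto].
      eapply incl_tran; [eassumption|]; apply VS_incl;
        auto using incl_refl, incl_tl.
    + intros Γ' Δ' H1 H2 H3; apply incl_cons_inv in H1 as [H1 H1'].
      apply H; auto; intros Y [<-|HY]; auto.
Qed.

(** Once its prime formulas are decided, [A] has a truth value and can be erased from one of the two
    premises, so the cut on [A] itself disappears. *)
Lemma rderivable_cut G A Γ Δ :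
  incl (V A) (VS Γ Δ) ->
  rderivable G Γ (A :: Δ) -> rderivable G (A :: Γ) Δ -> rderivable G Γ Δ.
Proof.
  intros HV H1 H2; apply (rderivable_split_primes G (primes A)).
  - intros X HX; split; [eapply primes_prime; eauto|].
    eapply incl_tran; [apply V_primes; exact HX|exact HV].
  - intros Γ' Δ' HΓ HΔ HX.
    assert (HV' : incl (V A) (VS Γ' Δ')).
    { eapply incl_tran; [exact HV|apply VS_incl; assumption]. }
    destruct (val_total Γ' Δ' A HX) as [Hv|Hv];
      [apply (rderivable_absorb _ _ _ H2) | apply (rderivable_absorb _ _ _ H1)];
      repeat constructor; unfold absorbed; auto;
      apply Forall_forall; intros; left; auto.
Qed.

(** * Removing extraneous atoms *)

Fixpoint restrict (f : nat -> bool) (A : form) : form :=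
  match A with
  | Atom p => if f p then Atom p else Bot
  | Bot => Bot
  | And A B => And (restrict f A) (restrict f B)
  | Or A B => Or (restrict f A) (restrict f B)
  | Neg A => Neg (restrict f A)
  | Box A => Box (restrict f A)
  end.

Lemma in_V_restrict f A p :
  In p (V (restrict f A)) <-> In p (V A) /\ f p = true.
Proof.
  induction A; simpl; try rewrite !in_app_iff; try tauto.
  destruct (f p0) eqn:E; simpl; split; [|tauto..|].
  - intros [->|[]]; auto.
  - intros [[->|[]] ?]; congruence.
Qed.

Lemma restrict_ext f g A :
  (forall p, In p (V A) -> f p = g p) -> restrict f A = restrict g A.
Proof.
  induction A; simpl; intros H; try reflexivity;
    try (f_equal; auto using in_or_app; fail).
  now rewrite H by auto.
Qed.

Lemma restrict_true A : restrict (fun _ => true) A = A.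
Proof. induction A; simpl; congruence. Qed.

Lemma map_restrict_Box f Γ :
  map (restrict f) (map Box Γ) = map Box (map (restrict f) Γ).
Proof. now rewrite !map_map. Qed.

Definition mem (l : list nat) (p : nat) : bool := existsb (Nat.eqb p) l.

Lemma mem_In l p : mem l p = true <-> In p l.
Proof.
  unfold mem; rewrite existsb_exists; split.
  - intros [x [Hx E]]; apply PeanoNat.Nat.eqb_eq in E; congruence.
  - intros Hp; exists p; split; [exact Hp|apply PeanoNat.Nat.eqb_refl].
Qed.

(** [f] stays general in the induction so that a cut may use a smaller one in its premises: dropping
    the atoms foreign to the conclusion leaves the conclusion alone and brings the cut formula
    within its atoms. *)
Lemma rderivable_restrict G Γ Δ :
  derivable G Γ Δ ->
  forall f, rderivable G (map (restrict f) Γ) (map (restrict f) Δ).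
Proof.
  induction 1; intros f; rewrite ?map_restrict_Box; simpl in *;
    try (now constructor).
  (* An erased atom turns the axiom into an identity on [Bot]. *)
  - destruct (f p); [apply r_ax_atom|].
    apply r_incl with [Bot] []; [apply incl_refl|apply incl_nil_l|].
    apply r_ax_bot.
  - eapply r_incl; [| |apply IHderivable]; apply incl_map;
      intros x Hx; eapply Permutation_in; eauto.
  - eapply r_incl; [| |apply IHderivable]; auto using incl_refl, incl_tl.
  - eapply r_incl; [| |apply IHderivable]; auto using incl_refl, incl_tl.
  - eapply rderivable_Lin; [|apply IHderivable]; left; reflexivity.
  - eapply rderivable_Rin; [|apply IHderivable]; left; reflexivity.
  - set (U := VS (map (restrict f) Γ) (map (restrict f) Δ)).
    set (g := fun p => f p && mem U p).
    assert (Hg : forall X, In X Γ \/ In X Δ -> restrict g X = restrict f X).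
    { intros X HX; apply restrict_ext; intros p Hp; unfold g.
      destruct (f p) eqn:E; [|reflexivity]; apply mem_In, in_VS.
      exists (restrict f X); split; [|apply in_V_restrict; auto].
      destruct HX; [left|right]; apply in_map; assumption. }
    specialize (IHderivable1 g); specialize (IHderivable2 g).
    assert (EΓ : map (restrict g) Γ = map (restrict f) Γ)
      by (apply map_ext_in; auto).
    assert (EΔ : map (restrict g) Δ = map (restrict f) Δ)
      by (apply map_ext_in; auto).
    rewrite EΓ, EΔ in *.
    apply (rderivable_cut G (restrict g A)); auto.
    intros p Hp; apply in_V_restrict in Hp as [_ Hp].
    apply andb_true_iff in Hp as [_ Hp]; apply mem_In; exact Hp.
  - apply r_4; auto.
    specialize (IHderivable f); rewrite map_app, map_restrict_Box in IHderivable.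
    exact IHderivable.
Qed.

Lemma derivable_rderivable G Γ Δ : derivable G Γ Δ -> rderivable G Γ Δ.
Proof.
  intro H; apply rderivable_restrict with (f := fun _ => true) in H.
  rewrite !(map_ext _ (fun A => A) restrict_true), !map_id in H; exact H.
Qed.

(** * Maehara interpolants *)

(** Hiding the proof gives a predicate to which [incl_closed] applies; [M] can be fixed up to
    equality because structural rules do not alter the interpolant. *)
Definition interpolated (G : logic) (Γ Δ : list sform) (M : form) : Prop :=
  exists π : split_proof G Γ Δ, all_cuts atomic_or_boxed π /\ maehara π = M.

Lemma prime_atomic_or_boxed A : prime A -> atomic_or_boxed A.
Proof. unfold atomic_or_boxed; destruct A; simpl; intuition eauto. Qed.

Lemma interpolated_incl G Γ Δ Γ' Δ' M :
  incl Γ Γ' -> incl Δ Δ' -> interpolated G Γ Δ M -> interpolated G Γ' Δ' M.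
Proof.
  intros HΓ HΔ H.
  apply (incl_closed (fun l => interpolated G l Δ' M)) with (l := Γ); auto.
  - intros l l' Hp [π Hπ].
    exists (s_exch G l l' Δ' Δ' Hp (Permutation_refl _) π); exact Hπ.
  - intros [s A] l [π Hπ]; exists (s_Lweak G s A l Δ' π); exact Hπ.
  - intros [s A] l [π Hπ]; exists (s_Lcontr G s A l Δ' π); exact Hπ.
  - apply (incl_closed (fun l => interpolated G Γ l M)) with (l := Δ); auto.
    + intros l l' Hp [π Hπ].
      exists (s_exch G Γ Γ l l' (Permutation_refl _) Hp π); exact Hπ.
    + intros [s A] l [π Hπ]; exists (s_Rweak G s A Γ l π); exact Hπ.
    + intros [s A] l [π Hπ]; exists (s_Rcontr G s A Γ l π); exact Hπ.
Qed.

Lemma interpolated_cut G s A Γ Δ M1 M2 :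
  prime A -> incl (V A) (Vside s Γ Δ) ->
  interpolated G Γ ((s, A) :: Δ) M1 -> interpolated G ((s, A) :: Γ) Δ M2 ->
  interpolated G Γ Δ (maehara_bin s M1 M2).
Proof.
  intros HA HV [π1 [H1 <-]] [π2 [H2 <-]].
  exists (s_cut G s A Γ Δ HV π1 π2); simpl.
  auto using prime_atomic_or_boxed.
Qed.

Lemma interpolated_ax G s t A :
  prime A -> interpolated G [(s, A)] [(t, A)] (maehara_ax s t A).
Proof.
  destruct A; simpl; try contradiction; intros _.
  - exists (s_ax_atom G s t p); simpl; auto.
  - exists (s_ax_box G s t A); simpl; auto.
Qed.

Definition tag (s : side) (Γ : list form) : list sform := map (pair s) Γ.

Lemma in_Vside s X Γ Δ p :
  In (s, X) Γ \/ In (s, X) Δ -> In p (V X) -> In p (Vside s Γ Δ).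
Proof.
  intros HX Hp; unfold Vside; apply in_flat_map; exists X; split; [|exact Hp].
  apply in_app_iff; unfold on_side.
  destruct HX; [left|right]; apply in_map_iff; exists (s, X);
    (split; [reflexivity|]); apply filter_In; split; auto; now destruct s.
Qed.

Lemma tag_Box s Γ : tag s (map Box Γ) = sboxes (tag s Γ).
Proof. unfold tag, sboxes; now rewrite !map_map. Qed.

(** What one-sidedness forces on an interpolant: falsity up to equivalence on the left, truth on the
    right. *)
Definition degenerate (G : logic) (s : side) (M : form) : Prop :=
  match s with Lft => derivable G [M] [] | Rgt => derivable G [] [M] end.

Lemma derivable_Top G : derivable G [] [Top].
Proof. apply provable_Imp, derivable_id. Qed.

Lemma degenerate_ax G s X : degenerate G s (maehara_ax s s X).
Proof. destruct s; simpl; [apply d_ax_bot|apply derivable_Top]. Qed.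

Lemma degenerate_bin G s M1 M2 :
  degenerate G s M1 -> degenerate G s M2 ->
  degenerate G s (maehara_bin s M1 M2).
Proof.
  destruct s; simpl; intros H1 H2; [apply d_Lor | apply d_Rand]; assumption.
Qed.

Lemma degenerate_box G s M :
  has_K G \/ has_4 G -> degenerate G s M -> degenerate G s (maehara_box s M).
Proof.
  intros HG.
  (* With an empty context, rule [K] or rule [4] is necessitation. *)
  assert (Hnec : forall A, derivable G [] [A] -> derivable G [] [Box A]).
  { intros A HA; destruct HG as [HG|HG].
    - exact (d_K G A [] HG HA).
    - exact (d_4 G A [] HG HA). }
  destruct s; simpl; intros H; [apply d_Lneg, Hnec, d_Rneg|apply Hnec];
    exact H.
Qed.

Lemma degenerate_D G s M :
  has_D G -> degenerate G s M -> degenerate G s (Box M).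
Proof.
  intros HG H; destruct s; simpl in *.
  - exact (d_D G [M] HG H).
  (* A provable [M] calls for necessitation, and each logic with rule [D] also has [K] or [4]. *)
  - apply (degenerate_box G Rgt); [|exact H].
    destruct G; simpl in *; tauto.
Qed.

(** On a single side the axioms yield [Bot] (left) or [Top] (right), and the operations attached to
    the other rules preserve degeneracy. *)
Lemma rderivable_interpolated G Γ Δ s :
  rderivable G Γ Δ ->
  exists M, interpolated G (tag s Γ) (tag s Δ) M /\ degenerate G s M.
Proof.
  induction 1 as
    [p|A| |Γ Γ' Δ Δ' HΓ HΔ H IH|A B Γ Δ H IH|A B Γ Δ H IH
    |A B Γ Δ H1 IH1 H2 IH2|A B Γ Δ H IH|A B Γ Δ H IH
    |A B Γ Δ H1 IH1 H2 IH2|A Γ Δ H IH|A Γ Δ H IH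
    |A Γ Δ HA HV H1 IH1 H2 IH2|A Γ HG H IH|Γ HG H IH|A Γ HG H IH|A Γ Δ HG H IH];
    try (destruct IH as [M [[π [Hc Hm]] Hd]]).
  - exists (maehara_ax s s (Atom p)); split;
      [apply interpolated_ax; exact I|apply degenerate_ax].
  - exists (maehara_ax s s (Box A)); split;
      [apply interpolated_ax; exact I|apply degenerate_ax].
  - exists (match s with Lft => Bot | Rgt => Top end); split.
    + exists (s_ax_bot G s); simpl; auto.
    + destruct s; simpl; [apply d_ax_bot|apply derivable_Top].
  - exists M; split; [|exact Hd].
    apply interpolated_incl with (tag s Γ) (tag s Δ);
      [apply incl_map, HΓ|apply incl_map, HΔ|exists π; auto].
  - exists M; split; [exists (s_Land1 G s A B _ _ π)|]; auto.
  - exists M; split; [exists (s_Land2 G s A B _ _ π)|]; auto.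
  - destruct IH1 as [M1 [[π1 [Hc1 <-]] Hd1]].
    destruct IH2 as [M2 [[π2 [Hc2 <-]] Hd2]].
    eexists; split; [exists (s_Rand G s A B _ _ π1 π2); simpl; eauto|].
    apply degenerate_bin; assumption.
  - exists M; split; [exists (s_Ror1 G s A B _ _ π)|]; auto.
  - exists M; split; [exists (s_Ror2 G s A B _ _ π)|]; auto.
  - destruct IH1 as [M1 [[π1 [Hc1 <-]] Hd1]].
    destruct IH2 as [M2 [[π2 [Hc2 <-]] Hd2]].
    eexists; split; [exists (s_Lor G s A B _ _ π1 π2); simpl; eauto|].
    apply degenerate_bin; assumption.
  - exists M; split; [exists (s_Lneg G s A _ _ π)|]; auto.
  - exists M; split; [exists (s_Rneg G s A _ _ π)|]; auto.
  - destruct IH1 as [M1 [Hi1 Hd1]].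
    destruct IH2 as [M2 [Hi2 Hd2]].
    exists (maehara_bin s M1 M2); split; [|apply degenerate_bin; assumption].
    apply interpolated_cut with A; auto.
    intros p Hp; apply HV, in_VS in Hp as [X [HX Hp]].
    apply in_Vside with X; [|exact Hp].
    destruct HX; [left|right]; apply in_map; assumption.
  - exists (maehara_box s M); split; [|apply degenerate_box; auto].
    rewrite tag_Box; exists (s_K G s A _ HG π); split; [exact Hc|now destruct Hm].
  - exists (Box M); split; [|apply degenerate_D; auto].
    rewrite tag_Box; exists (s_D G _ HG π); split; [exact Hc|now destruct Hm].
  - exists (maehara_box s M); split; [|apply degenerate_box; auto].
    revert π Hc Hm; unfold tag; rewrite map_app; fold (tag s (map Box Γ)).
    fold (tag s Γ); rewrite tag_Box; intros π Hc Hm.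
    exists (s_4 G s A _ HG π); split; [exact Hc|now destruct Hm].
  - exists M; split; [exists (s_T G s A _ _ HG π)|]; auto.
Qed.

Lemma derivable_interpolated G Γ Δ s :
  derivable G Γ Δ ->
  exists M, interpolated G (tag s Γ) (tag s Δ) M /\ degenerate G s M.
Proof. intro H; apply rderivable_interpolated, derivable_rderivable, H. Qed.

(** * Generating a prescribed interpolant *)

(** Such formulas may be cut on either side: on the left thanks to [A], on the right thanks to
    [B]. *)
Definition shared (A B X : form) : Prop :=
  prime X /\ incl (V X) (V A) /\ incl (V X) (V B).

(* The literals of [ts] and [fs] still have to be moved to the right side; those
   of [t'] and [f'] already are.  The interpolant is the conjunction of the
   literals in [ts] and the negations of those in [fs]. *)
Lemma interpolated_literals G A B t f ts fs t' f' :
  (forall X, In X (t ++ f) -> shared A B X) ->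
  incl ts t -> incl fs f ->
  derivable G (ts ++ t') (fs ++ B :: f') ->
  exists M,
    interpolated G (tag Lft (A :: t) ++ tag Rgt t')
      (tag Lft f ++ tag Rgt (B :: f')) M /\
    (forall Γ Δ, derivable G (ts ++ Γ) (fs ++ Δ) -> derivable G (M :: Γ) Δ) /\
    derivable G t (M :: f).
Proof.
  intros Hsh; revert fs t' f'; induction ts as [|X ts IHt].
  - intros fs; induction fs as [|X fs IHf]; intros t' f' Ht Hf H; simpl in *.
    (* All literals are on the right, whose part of the sequent is provable alone; its provable
       interpolant stands for the empty conjunction. *)
    + apply (derivable_interpolated _ _ _ Rgt) in H as [M [Hi Hd]].
      exists M; repeat split.
      * eapply interpolated_incl; [| |exact Hi]; solve_incl.
      * intros Γ Δ H; weaken H.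
      * simpl in Hd; weaken Hd.
    + apply incl_cons_inv in Hf as [HX Hf].
      destruct (Hsh X) as [Hp [HA HB]]; [apply in_app_iff; auto|].
      destruct (IHf t' (X :: f') Ht Hf) as [M [Hi [H1 H2]]]; [weaken H|].
      exists (And M (Neg X)); repeat split.
      (* In the second premise the right [X] of the antecedent meets the left [X] from [f]: an axiom
         with interpolant [Neg X]. *)
      * apply (interpolated_cut G Rgt X) with (M2 := Neg X); [exact Hp| | |].
        -- intros p Hpp; apply in_Vside with B; [|auto].
           right; apply in_app_iff; right; left; reflexivity.
        -- eapply interpolated_incl; [| |exact Hi]; solve_incl.
        -- eapply interpolated_incl; [| |apply (interpolated_ax G Rgt Lft X Hp)].
           ++ solve_incl.
           ++ apply incl_cons, incl_nil_l; apply in_app_iff; left.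
              apply in_map; exact HX.
      * intros Γ Δ HD; apply derivable_Land.
        apply (d_exch G (Neg X :: M :: Γ) _ Δ _); [constructor|auto|].
        apply d_Lneg, H1; weaken HD.
      * apply d_Rand; [exact H2|].
        apply d_Rneg; eapply derivable_in; [left; reflexivity|exact HX].
  - intros fs t' f' Ht Hf H; simpl in *.
    apply incl_cons_inv in Ht as [HX Ht].
    destruct (Hsh X) as [Hp [HA HB]]; [apply in_app_iff; auto|].
    destruct (IHt fs (X :: t') f' Ht Hf) as [M [Hi [H1 H2]]]; [weaken H|].
    exists (And X M); repeat split.
    (* Dually, the first premise is an axiom from the left [X] in [t], with interpolant [X]. *)
    + apply (interpolated_cut G Rgt X) with (M1 := X); [exact Hp| | |].
      * intros p Hpp; apply in_Vside with B; [|auto].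
        right; apply in_app_iff; right; left; reflexivity.
      * eapply interpolated_incl; [| |apply (interpolated_ax G Lft Rgt X Hp)].
        -- apply incl_cons, incl_nil_l; right; apply in_app_iff; left.
           apply in_map; exact HX.
        -- solve_incl.
      * eapply interpolated_incl; [| |exact Hi]; solve_incl.
    + intros Γ Δ HD; apply derivable_Land.
      apply (d_exch G (M :: X :: Γ) _ Δ _); [constructor|auto|].
      apply H1; weaken HD.
    + apply d_Rand; [|exact H2].
      eapply derivable_in; [exact HX|left; reflexivity].
Qed.

(** [Xs] is still to be decided, while [t] and [f] have been made true and false. [C] yields [M]
    only relative to that choice, but [M] entails [C] outright, since each disjunct carries the
    literals of its branch or is refutable. *)
Lemma interpolated_dnf G A B C Xs t f :
  derivable G [A] [C] -> derivable G [C] [B] ->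
  (forall X, In X (Xs ++ t ++ f) -> shared A B X) ->
  incl (primes C) (Xs ++ t ++ f) ->
  exists M,
    interpolated G (tag Lft (A :: t)) (tag Lft f ++ [(Rgt, B)]) M /\
    derivable G [M] [C] /\ derivable G (C :: t) (M :: f).
Proof.
  intros HAC HCB; revert t f; induction Xs as [|X Xs IH]; intros t f Hsh HC.
  - destruct (val_total t f C) as [Hv|Hv].
    + intros X HX; apply in_app_iff, HC, HX.
    + apply (val_derivable G) in Hv.
      destruct (interpolated_literals G A B t f t f [] [] Hsh)
        as [M [Hi [H1 H2]]]; auto using incl_refl.
      (* This cut on [C] is in the unrestricted calculus; [interpolated_literals] returns a proof
         with admissible cuts only. *)
      { rewrite app_nil_r; apply (d_cut G C); [weaken Hv|weaken HCB]. }
      exists M; repeat split.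
      * simpl in Hi; rewrite app_nil_r in Hi; exact Hi.
      * apply H1; rewrite app_nil_r; weaken Hv.
      * weaken H2.
    + apply (val_derivable G) in Hv.
      (* [A] entails [C], which the literals refute, so the left part is provable alone and
         contributes a refutable disjunct. *)
      destruct (derivable_interpolated G (A :: t) f Lft) as [M [Hi Hd]].
      { apply (d_cut G C); [weaken HAC|weaken Hv]. }
      simpl in Hd; exists M; repeat split.
      * eapply interpolated_incl; [apply incl_refl|apply incl_appl, incl_refl|].
        exact Hi.
      * weaken Hd.
      * weaken Hv.
  - destruct (Hsh X) as [Hp [HA HB]]; [left; reflexivity|].
    destruct (IH t (X :: f)) as [M1 [Hi1 [H1 H1']]].
    { intros Y HY; apply Hsh; revert HY; revert Y; solve_incl. }
    { eapply incl_tran; [exact HC|solve_incl]. }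
    destruct (IH (X :: t) f) as [M2 [Hi2 [H2 H2']]].
    { intros Y HY; apply Hsh; revert HY; revert Y; solve_incl. }
    { eapply incl_tran; [exact HC|solve_incl]. }
    exists (Or M1 M2); repeat split.
    + apply (interpolated_cut G Lft X) with (M1 := M1); [exact Hp| | |].
      * intros p Hpp; apply in_Vside with A; [|auto].
        left; left; reflexivity.
      * exact Hi1.
      * eapply interpolated_incl; [| |exact Hi2]; solve_incl.
    + apply d_Lor; assumption.
    (* Case distinction on [X]: [H1'] covers [X] false, [H2'] covers [X] true. *)
    + apply derivable_Ror, (d_cut G X); [weaken H1'|weaken H2'].
Qed.

Theorem theorem7p2 (G : logic) (A B C : form)
  (hAB : provable G (Imp A B))
  (hV : forall p : nat, In p (V C) -> In p (V A) /\ In p (V B))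
  (hAC : provable G (Imp A C))
  (hCB : provable G (Imp C B)) :
  exists π : split_proof G [(Lft, A)] [(Rgt, B)],
    all_cuts atomic_or_boxed π /\ provable G (Iff (maehara π) C).
Proof.
  apply provable_Imp in hAC, hCB.
  (* Nothing is decided at the outset, so the relative entailment from [C] to the interpolant
     becomes absolute. *)
  destruct (interpolated_dnf G A B C (primes C) [] [] hAC hCB)
    as [M [[π [Hc <-]] [H1 H2]]].
  - rewrite app_nil_r; intros X HX; split; [eapply primes_prime; eauto|].
    split; intros p Hp; apply (hV p); eapply V_primes; eauto.
  - rewrite app_nil_r; apply incl_refl.
  - exists π; split; [exact Hc|]; apply provable_Iff; assumption.
Qed.
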